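(* Let $-\infty<a<b<+\infty$, let $f:[a;b]\to\mathbb{R}$ be a càdlàg function and let $c>0$. Then $$\inf\left\{TV(f+h,[a;b]) : h:[a;b]\to\mathbb{R},\ \|h\|_\infty\le \tfrac12 c\right\}=TV^c(f,[a;b]).$$ Moreover, if $c\le \sup_{s,u\in[a;b]}|f(s)-f(u)|$, then there exists a unique càdlàg function $h^c:[a;b]\to\mathbb{R}$ such that $\|h^c\|_\infty\le\tfrac12 c$ and, for every $s\in(a;b]$, $$TV(f+h^c,[a;s])=TV^c(f,[a;s]).$$
   Context: $\|h\|_\infty:=\sup_{s\in[a;b]}|h(s)|$. For $a<s\le b$ and a function $g$ on $[a;b]$, the total variation is $TV(g,[a;s])=\sup_n\sup_{a\le t_0<t_1<\dots<t_n\le s}\sum_{i=1}^n|g(t_i)-g(t_{i-1})|\in[0,+\infty]$, and the truncated variation is $TV^c(f,[a;s])=\sup_n\sup_{a\le t_0<t_1<\dots<t_n\le s}\sum_{i=1}^n\max\{|f(t_i)-f(t_{i-1})|-c,0\}$. Càdlàg means right-continuous with left limits. *)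

(* Defs.v *)
From HB Require Import structures.
From mathcomp Require Import all_boot all_order all_algebra.
From mathcomp Require Import all_classical all_reals all_analysis.

Set Implicit Arguments.
Unset Strict Implicit.
Unset Printing Implicit Defensive.

Import Order.TTheory GRing.Theory Num.Theory.
Import numFieldNormedType.Exports.
Local Open Scope classical_set_scope.
Local Open Scope ring_scope.

(* A function on [a; b] is represented by a total function R -> R, of which
   every notion below only uses the values on [a; b]; accordingly, two such
   functions are identified when they agree on [a; b]. *)

(* The one-sided filters at t avoid t itself, and they are localized inside
   [a; b] because t < b for t^'+ and a < t for t^'-. *)
Definition cadlag (R : realType) (a b : R) (f : R -> R) : Prop :=
  (forall t, t \in `[a, b[ -> f x @[x --> t^'+] --> f t) /\
  (forall t, t \in `]a, b] -> cvg (f x @[x --> t^'-])).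

Definition sup_norm (R : realType) (a b : R) (h : R -> R) : \bar R :=
  ereal_sup [set `|h s|%:E | s in `[a, b]].

Definition oscillation (R : realType) (a b : R) (f : R -> R) : \bar R :=
  ereal_sup [set `|f p.1 - f p.2|%:E | p in `[a, b] `*` `[a, b]].

(* Only t 0, ..., t n matter. The case n = 0 contributes the value 0, which does
   not affect the supremum when a < b since all the sums are nonnegative. *)
Definition truncated_variations (R : realType) (c a b : R) (f : R -> R)
    : set R :=
  [set v | exists (n : nat) (t : nat -> R),
    [/\ a <= t 0%N, forall i, (i < n)%N -> t i < t i.+1, t n <= b &
        v = \sum_(i < n) Num.max (`|f (t i.+1) - f (t i)| - c) 0]].

Definition truncated_variation (R : realType) (c a b : R) (f : R -> R)
    : \bar R :=
  ereal_sup [set v%:E | v in truncated_variations c a b f].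

(* [total_variation] of MathComp-Analysis only uses the subdivisions whose
   endpoints are a and b; this lemma checks that it is the supremum over all
   the finite increasing sequences of points of [a; b]. *)
Lemma total_variationE (R : realType) (a b : R) (f : R -> R) : a <= b ->
  total_variation a b f =
  ereal_sup [set v%:E | v in
    [set v | exists (n : nat) (t : nat -> R),
      [/\ a <= t 0%N, forall i, (i < n)%N -> t i < t i.+1, t n <= b &
          v = \sum_(i < n) `|f (t i.+1) - f (t i)|]]].
Proof.
move=> ab; apply/eqP; rewrite eq_le; apply/andP; split.
  apply: ge_ereal_sup => _ [_ [s abs <-] <-].
  apply: ereal_sup_ubound; exists (variation a b f s) => //.
  exists (size s), (nth b (a :: s)); split => //.
  - case: abs => + _ i si; elim: s a i si {ab} => // y s ih a [|i] /= si.
      by case/andP.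
    by case/andP => _ /ih; apply.
  - by rewrite (itv_partition_nth_size _ abs).
  - by rewrite /variation big_mkord.
apply: ge_ereal_sup => _ [_ [n [t [at0 tinc tnb ->]]] <-].
have H m : (m <= n)%N -> a <= t m /\
    ((\sum_(i < m) `|f (t i.+1) - f (t i)|)%:E <= total_variation a (t m) f)%E.
  elim: m => [_|m ih mn]; first by rewrite big_ord0; split => //; exact: total_variation_ge0.
  have [atm le_m] := ih (ltnW mn); have tmm := ltW (tinc _ mn).
  split; first exact: le_trans tmm.
  rewrite big_ord_recr /= EFinD (total_variationD f atm tmm).
  by apply: leeD => //; exact: total_variation_ge.
have [atn /le_trans] := H n (leqnn n); apply.
by rewrite (total_variationD f atn tnb) leeDl// total_variation_ge0.
Qed.

(* Main.v *)
Require Import Defs.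
From HB Require Import structures.
From mathcomp Require Import all_boot all_order all_algebra.
From mathcomp Require Import all_classical all_reals all_analysis.
From mathcomp Require Import lra.
Import Order.TTheory GRing.Theory Num.Theory.
Import numFieldNormedType.Exports.
Local Open Scope classical_set_scope.
Local Open Scope ring_scope.

(** Write V s for the truncated variation of f on [a; s]. Everything rests on
    one description of V: it is the least nonnegative nondecreasing function w
    such that w s + |f u - f s| - c <= w u whenever s < u. Such a w is said
    below to dominate f at level c ([truncated_variation_le] and
    [dominates_truncated_variation]). At level 0, where the truncated variation
    is the total variation, domination of g by V says |g u - g s| <= V u - V s.

    Lower bound. If g stays within c / 2 of f, then |f u - f s| - c is at most
    |g u - g s|, so the total variation of g dominates f at level c.

    Existence. The inequality f t - f s - c <= |V t - V s| is exactly the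
    condition under which the band from f - c / 2 to f + c / 2 contains a
    function that is 1-Lipschitz for the pseudometric |V t - V s|, and
    McShane's formula g s = sup_t (f t - c / 2 - |V t - V s|) gives one
    ([dominated_selection]). Its variation on [a; s] is at most V s, hence
    equal to V s, for all s simultaneously; so the infimum is even attained.

    Regularity. Since V is the least dominating function, it is bounded by any
    other one, and a dominating function on [a; s] can be continued beyond s as
    long as f oscillates by at most c ([dominates_extend]). This gives the
    finiteness of V for a cadlag f, by a supremum argument, and the right
    continuity of V. As its increments are bounded by those of V, the
    function g is cadlag too.

    Uniqueness. Let g1 and g2 be two optimal functions, m their midpoint and
    d = g1 - g2. From max(|x|, |y|) = |x + y| / 2 + |x - y| / 2, the function
    V - |d - d a| / 2 dominates m at level 0; as m also stays within c / 2 of f,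
    V <= V - |d - d a| / 2, so d is constant. If e = |d| were positive, then m
    would stay within (c - e) / 2 of f, whence the stronger inequality
    V s + |f u - f s| - c + e <= V u. It makes max(V - e, 0) dominate f at level
    c, so V b = 0 by minimality, and the same inequality then bounds the
    oscillation of f by c - e, although it is at least c
    ([dominated_unique]). *)

Set Implicit Arguments.
Unset Strict Implicit.
Unset Printing Implicit Defensive.

(* An absolute value of the goal is replaced by its two possible values, whereas
   one of a hypothesis is only used through the inequalities x <= |x| and
   - x <= |x|; this keeps the number of calls to lra small. *)
Ltac norm_lra :=
  intros;
  repeat match goal with |- context [ `|?x| ] => case: (ger0P x) => ? end;
  repeat match goal with H : context [ @Num.norm ?A ?B ?x ] |- _ =>
    let y := fresh "y" in let e := fresh "e" in
    pose proof (ler_norm x : is_true (x <= @Num.norm A B x));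
    pose proof (lerNnormlW (lexx `|x|) : is_true (- @Num.norm A B x <= x));
    remember (@Num.norm A B x) as y eqn:e in *; clear e
  end;
  lra.

(** * Truncated variation as the least dominating function *)

Definition dominates (R : realType) (c : R) (f : R -> R) (a b : R)
    (w : R -> R) : Prop :=
  0 <= w a /\
  forall s u, a <= s -> s < u -> u <= b ->
    w s <= w u /\ w s + `|f u - f s| - c <= w u.

Lemma dominates_nd (R : realType) (c : R) (f : R -> R) (a b : R) (w : R -> R) :
  dominates c f a b w ->
  forall s u, a <= s -> s <= u -> u <= b -> w s <= w u.
Proof.
move=> [_ dw] s u as_; rewrite le_eqVlt => /predU1P[->//|su] ub.
by have [] := dw s u as_ su ub.
Qed.

Lemma dominatesW (R : realType) (c : R) (f : R -> R) (a b s : R) (w : R -> R) :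
  s <= b -> dominates c f a b w -> dominates c f a s w.
Proof.
by move=> sb [w0 dw]; split=> // x y ax xy /le_trans ys; apply: dw => //; exact: ys.
Qed.

(** Along any subdivision, the partial sums stay below w at the last point
    reached. *)
Lemma truncated_variation_le (R : realType) (c : R) (f : R -> R) (a b : R)
    (w : R -> R) :
  dominates c f a b w -> (truncated_variation c a b f <= (w b)%:E)%E.
Proof.
move=> dw; apply: ge_ereal_sup => _ [v [n [t [at0 tinc tnb ->]]] <-].
rewrite lee_fin.
have H m : (m <= n)%N -> [/\ a <= t m, t m <= b &
    \sum_(i < m) Num.max (`|f (t i.+1) - f (t i)| - c) 0 <= w (t m)].
  move=> mn.
  have tb : forall k, (m + k <= n)%N -> t m <= t (m + k)%N.
    elim=> [|k ih] mkn; first by rewrite addn0.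
    rewrite addnS in mkn *; apply: le_trans (ih (ltnW mkn)) (ltW (tinc _ _)).
    exact: mkn.
  have tmb : t m <= b.
    by have := tb (n - m)%N; rewrite subnKC// => /(_ (leqnn n))/le_trans; apply.
  elim: m mn tmb {tb} => [|m ih] mn tmb.
    split=> //; rewrite big_ord0; apply: (le_trans dw.1).
    exact: (dominates_nd dw).
  have tt := tinc _ mn.
  have [atm _ sm] := ih (ltnW mn) (le_trans (ltW tt) tmb).
  have [d1 d2] := dw.2 _ _ atm tt tmb.
  split=> //; first exact: le_trans (ltW tt).
  by rewrite big_ord_recr /=; case: (leP (_ - c) 0) => ?; lra.
have [atn _ /le_trans] := H n (leqnn n); apply.
exact: (dominates_nd dw).
Qed.

Lemma truncated_variation_ge0 (R : realType) (c : R) (f : R -> R) (a b : R) :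
  a <= b -> (0 <= truncated_variation c a b f)%E.
Proof.
move=> ab; apply: ereal_sup_ubound; exists 0 => //.
by exists 0%N, (fun=> a); split=> //; rewrite big_ord0.
Qed.

Lemma truncated_variation_nd (R : realType) (c : R) (f : R -> R) (a s b : R) :
  s <= b -> (truncated_variation c a s f <= truncated_variation c a b f)%E.
Proof.
move=> sb; apply: ge_ereal_sup => _ [v [n [t [at0 tinc tnb ->]]] <-].
apply: ereal_sup_ubound; eexists; last reflexivity.
by exists n, t; split=> //; exact: le_trans sb.
Qed.

Lemma fine_truncated_variation (R : realType) (c : R) (f : R -> R)
    (a s b : R) : a <= s -> s <= b ->
  (truncated_variation c a b f < +oo)%E ->
  (fine (truncated_variation c a s f))%:E = truncated_variation c a s f.
Proof.
move=> as_ sb fin_b; rewrite fineK// ge0_fin_numE ?truncated_variation_ge0//.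
exact: le_lt_trans (truncated_variation_nd _ _ _ sb) fin_b.
Qed.

(** The sums of the truncated variation whose subdivision ends exactly at s;
    unlike those of [truncated_variations], they can be continued by the
    increment of f between s and a later point. *)
Definition truncated_variation_at (R : realType) (c : R) (f : R -> R)
    (a s v : R) : Prop :=
  exists (n : nat) (t : nat -> R),
    [/\ a <= t 0%N, forall i, (i < n)%N -> t i < t i.+1, t n = s &
        v = \sum_(i < n) Num.max (`|f (t i.+1) - f (t i)| - c) 0].

Lemma truncated_variation_at_rcons (R : realType) (c : R) (f : R -> R)
    (a s u v : R) :
  truncated_variation_at c f a s v -> s < u ->
  truncated_variation_at c f a u (v + Num.max (`|f u - f s| - c) 0).
Proof.
move=> [n [t [at0 tinc <- ->]]] tnu.
exists n.+1, (fun i => if (i <= n)%N then t i else u); split=> //.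
- move=> i; rewrite ltnS => ile; rewrite ile.
  by move: ile; rewrite leq_eqVlt => /predU1P[->|/[dup] /tinc ? ->//]; rewrite ltnn.
- by rewrite ltnn.
- rewrite big_ord_recr /= leqnn ltnn; congr (_ + _).
  by apply: eq_bigr => i _; rewrite (ltn_ord i) (ltnW (ltn_ord i)).
Qed.

Lemma truncated_variation_at_le (R : realType) (c : R) (f : R -> R)
    (a s b v : R) :
  truncated_variation_at c f a s v -> s <= b ->
  (v%:E <= truncated_variation c a b f)%E.
Proof.
move=> [n [t [at0 tinc ts ->]]] sb.
apply: ereal_sup_ubound; eexists; last reflexivity.
by exists n, t; split=> //; rewrite ts.
Qed.

(** A subdivision of [a; s] is first continued up to s, which cannot decrease its
    sum, and then up to u. *)
Lemma truncated_variation_step (R : realType) (c : R) (f : R -> R)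
    (a s u : R) : s < u ->
  (truncated_variation c a s f + (`|f u - f s| - c)%:E
     <= truncated_variation c a u f)%E.
Proof.
move=> su; rewrite -leeBrDr//.
apply: ge_ereal_sup => _ [v [n [t [at0 tinc tns ve]]] <-].
have at_v : truncated_variation_at c f a (t n) v by exists n, t.
rewrite leeBrDr// -EFinD.
have [w at_w vw] : exists2 w, truncated_variation_at c f a s w & v <= w.
  move: tns; rewrite le_eqVlt => /predU1P[<-|tns]; first by exists v.
  eexists; first exact: truncated_variation_at_rcons at_v tns.
  by rewrite lerDl le_max lexx orbT.
apply: le_trans (truncated_variation_at_le (truncated_variation_at_rcons at_w su) (lexx _)).
by rewrite lee_fin lerD// le_max lexx.
Qed.

Lemma dominates_truncated_variation (R : realType) (c : R) (f : R -> R)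
    (a b : R) : a <= b ->
  (truncated_variation c a b f < +oo)%E ->
  dominates c f a b (fun s => fine (truncated_variation c a s f)).
Proof.
move=> ab fin_b.
split=> [|s u as_ su ub]; first by rewrite fine_ge0// truncated_variation_ge0.
have sE := fine_truncated_variation as_ (ltW (lt_le_trans su ub)) fin_b.
have uE := fine_truncated_variation (ltW (le_lt_trans as_ su)) ub fin_b.
split; first by rewrite -lee_fin sE uE truncated_variation_nd// ltW.
by rewrite -lee_fin -addrA EFinD sE uE truncated_variation_step.
Qed.

Lemma truncated_variation_start (R : realType) (c : R) (f : R -> R) (a : R) :
  truncated_variation c a a f = 0%E.
Proof.
apply/eqP; rewrite eq_le truncated_variation_ge0// andbT.
apply: (@truncated_variation_le _ _ _ _ _ (fun=> 0)); split=> // s u as_ su ua.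
by have := le_lt_trans as_ (lt_le_trans su ua); rewrite ltxx.
Qed.

(** * Comparison with the total variation *)

Lemma total_variation_truncated (R : realType) (a b : R) (g : R -> R) :
  a <= b -> total_variation a b g = truncated_variation 0 a b g.
Proof.
move=> ab; rewrite total_variationE//; congr ereal_sup.
congr (_ @` _); apply/funext => v; apply: propext.
by split=> -[n [t [at0 tinc tnb ->]]]; exists n, t; split=> //;
  apply: eq_bigr => i _; rewrite subr0 max_l.
Qed.

(** The total variation of g, when finite, dominates f at level c, because
    |f u - f s| <= |g u - g s| + c. *)
Lemma truncated_variation_le_tube (R : realType) (c : R) (f g : R -> R)
    (a b : R) : a <= b ->
  (forall s, a <= s -> s <= b -> `|g s - f s| <= c / 2) ->
  (truncated_variation c a b f <= truncated_variation 0 a b g)%E.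
Proof.
move=> ab gf.
have := truncated_variation_ge0 0 g ab.
case E : truncated_variation => [r| |] // _; last by rewrite leey.
have fin_g : (truncated_variation 0 a b g < +oo)%E by rewrite E ltry.
have [v0 dv] := dominates_truncated_variation ab fin_g.
have -> : r = fine (truncated_variation 0 a b g) by rewrite E.
apply: (@truncated_variation_le _ _ _ _ _
  (fun s => fine (truncated_variation 0 a s g))).
split=> // s u as_ su ub; have [vsu vabs] := dv s u as_ su ub; split=> //.
have := gf s as_ (ltW (lt_le_trans su ub)).
have := gf u (ltW (le_lt_trans as_ su)) ub.
norm_lra.
Qed.

(** * Finiteness and right continuity *)

(** Inside ]s; t[ the increments of f do not exceed c, so that w can be kept
    constant there. The first increment reaching beyond s is split at s: its part
    after s costs at most k. An increment ending at t costs |f t - f s|, plus k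
    if it starts after s. *)
Lemma dominates_extend (R : realType) (c : R) (f : R -> R) (a s t k : R)
    (w : R -> R) : 0 <= c -> a <= s -> 0 <= k ->
  dominates c f a s w ->
  (forall x, s < x -> x < t -> `|f x - f s| <= k) ->
  (forall x y, s < x -> x < y -> y < t -> `|f y - f x| <= c) ->
  dominates c f a t (fun x => if x <= s then w x else
    if x < t then w s + k else w s + k + (k + `|f t - f s|)).
Proof.
move=> c0 as_ k0 dw fk fc; split; first by rewrite as_; exact: dw.1.
move=> x y ax xy yt; have [ys|sy] := leP y s.
  by rewrite (le_trans (ltW xy) ys); exact: dw.2.
have wxs : x <= s -> w x <= w s /\ (x = s \/ w x + `|f s - f x| - c <= w s).
  rewrite le_eqVlt => /predU1P[->|xs]; first by split=> //; left.
  by have [? ?] := dw.2 _ _ ax xs (lexx s); split=> //; right.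
have [{}yt|ty] := ltP y t.
- have fys := fk y sy yt.
  have [xs|sx] := leP x s.
    have [w1 [xe|w2]] := wxs xs; first by rewrite xe; split; norm_lra.
    by split; norm_lra.
  have fxy := fc x y sx xy yt.
  by rewrite (lt_trans xy yt); split=> //; norm_lra.
- have yt' : y = t by apply/eqP; rewrite eq_le yt.
  rewrite {}yt' in xy sy *.
  have [xs|sx] := leP x s.
    have [w1 [xe|w2]] := wxs xs; first by rewrite xe; split; norm_lra.
    by split; norm_lra.
  have fxs := fk x sx xy.
  by rewrite xy; split; norm_lra.
Qed.

Lemma cadlag_right (R : realType) (a b : R) (f : R -> R) (t eps : R) :
  cadlag a b f -> a <= t -> t < b -> 0 < eps ->
  exists u, [/\ t < u, u <= b & forall x, t < x -> x < u -> `|f x - f t| <= eps].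
Proof.
move=> [fr _] at_ tb e0.
have /fr/cvgr_distC_le/(_ _ e0)[d /= d0 Hd] : t \in `[a, b[ by rewrite in_itv /= at_.
exists (Num.min b (t + d)); split.
- by rewrite lt_min tb ltrDl.
- by rewrite ge_min lexx.
- move=> x tx; rewrite lt_min => /andP[_ xd]; apply: Hd => //=.
  by rewrite ltr0_norm ?subr_lt0//; lra.
Qed.

Lemma cadlag_left (R : realType) (a b : R) (f : R -> R) (t eps : R) :
  cadlag a b f -> a < t -> t <= b -> 0 < eps ->
  exists l s, [/\ a <= s, s < t & forall x, s < x -> x < t -> `|f x - l| <= eps].
Proof.
move=> [_ fl] at_ tb e0.
have /fl/cvg_ex[l /cvgr_distC_le/(_ _ e0)[d /= d0 Hd]] : t \in `]a, b] by rewrite in_itv /= at_.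
exists l, (Num.max a (t - d)); split.
- by rewrite le_max lexx.
- by rewrite gt_max at_ /= ltrBlDr ltrDl.
- move=> x; rewrite gt_max => /andP[_ xd] xt; apply: Hd => //=.
  by rewrite gtr0_norm ?subr_gt0//; lra.
Qed.

(** Let z be the supremum of the s such that f is dominated on [a; s]. Since
    f oscillates by at most c on some interval with right endpoint z (left limit)
    and on some interval with left endpoint z (right continuity),
    [dominates_extend] shows that z is one of these s, and that z = b. *)
Lemma cadlag_dominated (R : realType) (c : R) (f : R -> R) (a b : R) :
  a <= b -> 0 < c -> cadlag a b f -> exists w, dominates c f a b w.
Proof.
move=> ab c0 fcl.
pose S := [set s | [/\ a <= s, s <= b & exists w, dominates c f a s w]].
have Sa : S a.
  split=> //; exists (fun=> 0); split=> // s u as_ su ua.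
  by have := le_lt_trans as_ (lt_le_trans su ua); rewrite ltxx.
have ubS : has_ubound S by exists b => s [].
pose z := sup S.
have az : a <= z by exact: ub_le_sup.
have zb : z <= b by apply: ge_sup; [exists a|move=> s []].
have [wz dwz] : exists w, dominates c f a z w.
  move: (az); rewrite le_eqVlt => /predU1P[<-|{}az]; first by case: Sa.
  have c4 : 0 < c / 2 by rewrite divr_gt0.
  have [l [s [as_ sz Hs]]] := cadlag_left fcl az zb c4.
  have zs0 : 0 < z - s by rewrite subr_gt0.
  have [r Sr] := @sup_adherent _ S _ zs0 (conj (ex_intro _ a Sa) ubS).
  rewrite -/z subKr => sr; have [ar rb [w dw]] := Sr.
  eexists; apply: (@dominates_extend _ _ _ _ r z (c / 2 + `|l - f r|) _ (ltW c0) ar _ dw).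
  - by rewrite addr_ge0 ?normr_ge0 ?(ltW c4).
  - move=> x rx xz; have := Hs x (lt_trans sr rx) xz; norm_lra.
  - move=> x y rx xy yz; have := Hs x (lt_trans sr rx) (lt_trans xy yz).
    by have := Hs y (lt_trans sr (lt_trans rx xy)) yz; norm_lra.
move: (zb); rewrite le_eqVlt => /predU1P[<-|{}zb]; first by exists wz.
have c2 : 0 < c / 2 by rewrite divr_gt0.
have [u [zu ub Hu]] := cadlag_right fcl az zb c2.
suff : u <= z by rewrite leNgt zu.
apply: ub_le_sup => //; split=> //; first exact: le_trans (ltW zu).
eexists; apply: (@dominates_extend _ _ _ _ z u (c / 2) _ (ltW c0) az (ltW c2) dwz Hu).
move=> x y zx xy yu; have := Hu x zx (lt_trans xy yu).
by have := Hu y (lt_trans zx xy) yu; norm_lra.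
Qed.

Lemma cadlag_truncated_variation_lty (R : realType) (c : R) (f : R -> R) (a b : R) :
  a <= b -> 0 < c -> cadlag a b f -> (truncated_variation c a b f < +oo)%E.
Proof.
move=> ab c0 /(cadlag_dominated ab c0)[w /truncated_variation_le].
by move=> /le_lt_trans; apply; rewrite ltry.
Qed.

(** If f stays within e' <= c / 2 of f t just after t, then V continued by the
    constant V t + e' dominates f, so V is at most V t + e' there. *)
Lemma truncated_variation_right_continuous (R : realType) (c : R) (f : R -> R)
    (a b t : R) : 0 < c -> cadlag a b f -> a <= t -> t < b ->
  fine (truncated_variation c a x f) @[x --> t^'+] -->
  fine (truncated_variation c a t f).
Proof.
move=> c0 fcl at_ tb; apply/cvgrPdist_le => e e0.
have ab := le_trans at_ (ltW tb).
have fin_b := cadlag_truncated_variation_lty ab c0 fcl.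
have dv := dominates_truncated_variation ab fin_b.
pose e' := Num.min e (c / 2).
have e'0 : 0 < e' by rewrite lt_min e0 divr_gt0.
have e'e : e' <= e by rewrite ge_min lexx.
have e'c : e' <= c / 2 by rewrite ge_min lexx orbT.
have [u [tu ub Hu]] := cadlag_right fcl at_ tb e'0.
have Hc y z : t < y -> y < z -> z < u -> `|f z - f y| <= c.
  move=> ty yz zu; have := Hu y ty (lt_trans yz zu).
  by have := Hu z (lt_trans ty yz) zu; norm_lra.
have du := dominates_extend (ltW c0) at_ (ltW e'0) (dominatesW (ltW tb) dv) Hu Hc.
near=> x.
have tx : t < x by near: x; exact: nbhs_right_gt.
have xu : x < u by near: x; exact: nbhs_right_lt.
have xb := ltW (lt_le_trans xu ub).
have vtx := dominates_nd dv at_ (ltW tx) xb.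
have := truncated_variation_le (dominatesW (ltW xu) du).
rewrite /= (leNgt x t) tx /= xu.
by rewrite -(fine_truncated_variation (le_trans at_ (ltW tx)) xb fin_b) lee_fin; norm_lra.
Unshelve. all: by end_near. Qed.

(** * Existence of an optimal function *)

(** McShane's formula. The pseudometric |v t - v s| satisfies
    f t - f s - c <= |v t - v s| since v dominates f, which keeps g below
    f + c / 2; taking t = s keeps it above f - c / 2. *)
Lemma dominated_selection (R : realType) (c : R) (f : R -> R) (a b : R)
    (v : R -> R) : a <= b -> 0 <= c -> dominates c f a b v ->
  exists2 g : R -> R, (forall s, a <= s -> s <= b -> `|g s - f s| <= c / 2) &
    dominates 0 g a b v.
Proof.
move=> ab c0 dv.
pose A s := [set f t - c / 2 - `|v t - v s| | t in [set t | a <= t <= b]].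
pose g s := sup (A s).
have A_le s x : a <= s -> s <= b -> A s x -> x <= f s + c / 2.
  move=> as_ sb [t /= /andP[at_ tb] <-].
  have [st|ts|->] := ltgtP s t.
  - by have [? ?] := dv.2 _ _ as_ st tb; norm_lra.
  - by have [? ?] := dv.2 _ _ at_ ts sb; norm_lra.
  - norm_lra.
have g_ge s t : a <= s -> s <= b -> a <= t -> t <= b ->
    f t - c / 2 - `|v t - v s| <= g s.
  move=> as_ sb at_ tb; apply: ub_le_sup; last by exists t => //=; rewrite at_.
  by exists (f s + c / 2) => x; exact: A_le.
have g_le s M : (forall t, a <= t -> t <= b ->
    f t - c / 2 - `|v t - v s| <= M) -> g s <= M.
  move=> HM; apply: ge_sup; first by exists (f a - c / 2 - `|v a - v s|), a; rewrite //= lexx.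
  by move=> _ [t /= /andP[at_ tb] <-]; exact: HM.
exists g.
  move=> s as_ sb; rewrite ler_distl; apply/andP; split.
    by have := g_ge s s as_ sb as_ sb; rewrite subrr normr0 subr0.
  by apply: g_le => t at_ tb; apply: A_le => //; exists t => //=; rewrite at_.
split; first exact: dv.1.
move=> s u as_ su ub.
have au := le_trans as_ (ltW su); have sb := le_trans (ltW su) ub.
have vsu := dominates_nd dv as_ (ltW su) ub.
have gus : g u <= g s + (v u - v s).
  by apply: g_le => t at_ tb; have := g_ge s t as_ sb at_ tb; case: (ger0P (v t - v s)); norm_lra.
have gsu : g s <= g u + (v u - v s).
  by apply: g_le => t at_ tb; have := g_ge u t au ub at_ tb; case: (ger0P (v t - v u)); norm_lra.
by split=> //; norm_lra.
Qed.

(** Left limits exist because v + g and v - g are nondecreasing. *)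
Lemma dominated_cadlag (R : realType) (g v : R -> R) (a b : R) :
  dominates 0 g a b v ->
  (forall t, a <= t -> t < b -> v x @[x --> t^'+] --> v t) ->
  cadlag a b g.
Proof.
move=> dg vr; split=> t; rewrite in_itv /= => /andP[].
- move=> at_ tb; apply/cvgrPdist_le => e e0.
  have /cvgrPdist_le/(_ _ e0) Hv := vr t at_ tb.
  near=> x.
  have tx : t < x by near: x; exact: nbhs_right_gt.
  have xb : x <= b by apply: ltW; near: x; exact: nbhs_right_lt.
  have [? ?] := dg.2 t x at_ tx xb.
  have : `|v t - v x| <= e by near: x.
  norm_lra.
- move=> at_ tb.
  have mono (p : R -> R) : (forall x y, a <= x -> x < y -> y <= b -> p x <= p y) ->
      cvg (p x @[x --> t^'-]).
    move=> pnd; apply: nondecreasing_at_left_is_cvgr.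
      near=> r => x y; rewrite !in_itv /= => /andP[rx xt] /andP[ry yt].
      rewrite le_eqVlt => /predU1P[->//|xy].
      apply: pnd => //; last exact: le_trans (ltW yt) tb.
      by apply: le_trans (ltW rx); near: r; exact: nbhs_left_ge.
    near=> r; exists (p t) => _ [x + <-].
    rewrite /= in_itv /= => /andP[rx xt]; apply: pnd => //.
    by apply: le_trans (ltW rx); near: r; exact: nbhs_left_ge.
  have -> : g = (fun x => (v x + g x) / 2) \- (fun x => (v x - g x) / 2).
    by apply/funext => x /=; lra.
  apply: is_cvgB; apply: mono => x y ax xy yb;
    by have [? ?] := dg.2 x y ax xy yb; norm_lra.
Unshelve. all: by end_near. Qed.

(** * Uniqueness *)

Lemma dominated_unique (R : realType) (c : R) (f g1 g2 : R -> R) (a b : R) :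
  let v s := fine (truncated_variation c a s f) in
  a <= b -> (truncated_variation c a b f < +oo)%E ->
  (c%:E <= oscillation a b f)%E ->
  (forall s, a <= s -> s <= b -> `|g1 s - f s| <= c / 2) ->
  (forall s, a <= s -> s <= b -> `|g2 s - f s| <= c / 2) ->
  dominates 0 g1 a b v -> dominates 0 g2 a b v ->
  forall s, a <= s -> s <= b -> g1 s = g2 s.
Proof.
move=> v ab fin_b osc tube1 tube2 dv1 dv2.
have dv : dominates c f a b v := dominates_truncated_variation ab fin_b.
have vE s : a <= s -> s <= b -> (v s)%:E = truncated_variation c a s f.
  by move=> as_ sb; exact: fine_truncated_variation as_ sb fin_b.
pose m s := (g1 s + g2 s) / 2.
(* This is max(|x|, |y|) = |x + y| / 2 + |x - y| / 2 for the increments of g1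
   and g2, together with the triangle inequality for g1 - g2. *)
have dm : dominates 0 m a b
    (fun s => v s - `|(g1 s - g2 s) - (g1 a - g2 a)| / 2).
  split=> [|s u as_ su ub]; first by rewrite subrr normr0 mul0r subr0; exact: dv.1.
  have [_] := dv1.2 s u as_ su ub; have [_] := dv2.2 s u as_ su ub.
  by rewrite /m => ? ?; split; norm_lra.
have const s : a <= s -> s <= b -> g1 s - g2 s = g1 a - g2 a.
  move=> as_ sb.
  have : (truncated_variation c a s f <= truncated_variation 0 a s m)%E.
    apply: truncated_variation_le_tube => // x ax xs.
    have := tube1 x ax (le_trans xs sb); have := tube2 x ax (le_trans xs sb).
    by rewrite /m; norm_lra.
  move=> /le_trans/(_ (truncated_variation_le (dominatesW sb dm))).
  by rewrite -vE// lee_fin; norm_lra.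
pose e := `|g1 a - g2 a|.
suff e0 : e = 0.
  move=> s as_ sb; apply/eqP; rewrite -subr_eq0 const//.
  by rewrite -normr_eq0 -/e e0.
apply/eqP; rewrite eq_le normr_ge0 andbT leNgt; apply/negP => e0.
(* Both m + e / 2 and m - e / 2 lie in the band around f. *)
have mf s : a <= s -> s <= b -> `|m s - f s| <= (c - e) / 2.
  move=> as_ sb; have := tube1 s as_ sb; have := tube2 s as_ sb.
  have := const s as_ sb; rewrite /m /e; norm_lra.
have ce0 : 0 <= c - e by have := mf a (lexx a) ab; norm_lra.
have ve s u : a <= s -> s < u -> u <= b -> v s + `|f u - f s| - c + e <= v u.
  move=> as_ su ub; have [_] := dm.2 s u as_ su ub.
  have := mf s as_ (ltW (lt_le_trans su ub)).
  have := mf u (le_trans as_ (ltW su)) ub.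
  rewrite !const ?subrr ?normr0//; first norm_lra.
    exact: le_trans as_ (ltW su).
  exact: ltW (lt_le_trans su ub).
(* An increment of f beyond c costs v at least e more than needed, so v can be
   lowered by e; minimality of v then forces v b = 0. *)
have vb0 : v b = 0.
  have dve : dominates c f a b (fun s => Num.max (v s - e) 0).
    split=> [|s u as_ su ub]; first by rewrite le_max lexx orbT.
    have := ve s u as_ su ub; have := dominates_nd dv as_ (ltW su) ub.
    have := dominates_nd dv (lexx a) as_ (ltW (lt_le_trans su ub)).
    have := dv.1.
    case: (leP (v s - e) 0) => ?; case: (leP (v u - e) 0) => ? ? ? ? ?; split; lra.
  have := truncated_variation_le dve.
  rewrite -vE// lee_fin; have := dominates_nd dv (lexx a) ab (lexx b).
  by have := dv.1; case: (leP (v b - e) 0) => ? ? ? ?; lra.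
have osc_e s u : a <= s -> s < u -> u <= b -> `|f u - f s| <= c - e.
  move=> as_ su ub; have := ve s u as_ su ub.
  have := dominates_nd dv (lexx a) as_ (ltW (lt_le_trans su ub)).
  have := dominates_nd dv (le_trans as_ (ltW su)) ub (lexx b).
  by have := dv.1; lra.
have : (oscillation a b f <= (c - e)%:E)%E.
  apply: ge_ereal_sup => _ [[s u] [/= sab uab] <-]; rewrite lee_fin.
  move: sab uab; rewrite /= !in_itv /= => /andP[as_ sb] /andP[au ub].
  have [su|us|->] := ltgtP s u; last by rewrite subrr normr0.
  - by rewrite distrC osc_e.
  - by rewrite osc_e.
by move=> /(le_trans osc); rewrite lee_fin; lra.
Qed.

(** * The optimal perturbation *)

Lemma sup_norm_le (R : realType) (a b k : R) (h : R -> R) :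
  (sup_norm a b h <= k%:E)%E <-> forall s, a <= s -> s <= b -> `|h s| <= k.
Proof.
split=> [hk s as_ sb|hk].
  rewrite -lee_fin; apply: le_trans hk; apply: ereal_sup_ubound.
  by exists s => //=; rewrite in_itv /= as_.
apply: ge_ereal_sup => _ [s + <-]; rewrite /= in_itv /= => /andP[as_ sb].
by rewrite lee_fin hk.
Qed.

Unset Implicit Arguments.

Theorem mainTheorem1 (R : realType) (a b : R) (f : R -> R) (c : R)
    (ab : a < b) (f_cadlag : cadlag a b f) (c_gt0 : 0 < c) :
  ereal_inf [set total_variation a b (f \+ h) |
              h in [set h : R -> R | (sup_norm a b h <= (c / 2)%:E)%E]]
    = truncated_variation c a b f
  /\
  ((c%:E <= oscillation a b f)%E ->
   exists hc : R -> R,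
     [/\ cadlag a b hc,
         (sup_norm a b hc <= (c / 2)%:E)%E &
         forall s, s \in `]a, b] ->
           total_variation a s (f \+ hc) = truncated_variation c a s f] /\
     forall h : R -> R,
       cadlag a b h ->
       (sup_norm a b h <= (c / 2)%:E)%E ->
       (forall s, s \in `]a, b] ->
          total_variation a s (f \+ h) = truncated_variation c a s f) ->
       {in `[a, b], h =1 hc}).
Proof.
pose v s := fine (truncated_variation c a s f).
have fin_b := cadlag_truncated_variation_lty (ltW ab) c_gt0 f_cadlag.
have dv : dominates c f a b v := dominates_truncated_variation (ltW ab) fin_b.
have vE s : a <= s -> s <= b -> (v s)%:E = truncated_variation c a s f.
  by move=> as_ sb; exact: fine_truncated_variation as_ sb fin_b.
have lower h s : (sup_norm a b h <= (c / 2)%:E)%E -> a <= s -> s <= b ->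
    (truncated_variation c a s f <= truncated_variation 0 a s (f \+ h)%R)%E.
  move=> /sup_norm_le hc as_ sb; apply: truncated_variation_le_tube => // x ax xs.
  by rewrite /= addrAC subrr add0r hc// (le_trans xs sb).
have [g gf dg] := dominated_selection (ltW ab) (ltW c_gt0) dv.
pose hc := g \- f.
have fhc : f \+ hc = g by apply/funext => x; rewrite /= addrC subrK.
have hc_small : (sup_norm a b hc <= (c / 2)%:E)%E by apply/sup_norm_le.
have opt s : a <= s -> s <= b ->
    total_variation a s (f \+ hc) = truncated_variation c a s f.
  move=> as_ sb; rewrite total_variation_truncated//; apply/eqP.
  rewrite eq_le lower// andbT fhc -vE//.
  exact: truncated_variation_le (dominatesW sb dg).
split.
  apply/eqP; rewrite eq_le; apply/andP; split.
    by apply: ereal_inf_lbound; exists hc => //; apply: opt => //; exact: ltW.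
  apply: le_ereal_inf_tmp => _ [h /= hs <-].
  rewrite total_variation_truncated ?(ltW ab)//; exact: (lower _ _ hs (ltW ab) (lexx b)).
move=> osc; exists hc; split.
  split=> //; last by move=> s; rewrite in_itv /= => /andP[as_ sb]; apply: opt => //; exact: ltW.
  have [gr gl] : cadlag a b g.
    apply: dominated_cadlag dg _ => t at_ tb.
    exact: truncated_variation_right_continuous f_cadlag at_ tb.
  split=> t tab; first by apply: cvgB; [exact: gr|exact: f_cadlag.1].
  by apply: is_cvgB; [exact: gl|exact: f_cadlag.2].
move=> h _ hs hopt s; rewrite in_itv /= => /andP[as_ sb].
have dh : dominates 0 (f \+ h) a b v.
  have tvE x : a <= x -> x <= b -> truncated_variation 0 a x (f \+ h) =
      truncated_variation c a x f.
    rewrite le_eqVlt => /predU1P[<- _|ax xb]; first by rewrite !truncated_variation_start.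
    by rewrite -total_variation_truncated ?ltW// hopt// in_itv /= ax.
  have := @dominates_truncated_variation _ 0 (f \+ h) _ _ (ltW ab).
  rewrite tvE ?(ltW ab)// => /(_ fin_b) [d0 dd]; split; first exact: dv.1.
  move=> x y ax xy yb; have := dd x y ax xy yb.
  by rewrite !tvE// ?(le_trans ax (ltW xy)) ?(le_trans (ltW xy) yb).
have hf x : a <= x -> x <= b -> `|(f \+ h) x - f x| <= c / 2.
  by move=> ax xb; rewrite /= addrAC subrr add0r; move/sup_norm_le: hs; apply.
have := dominated_unique (ltW ab) fin_b osc hf gf dh dg as_ sb.
by rewrite /hc /= => <-; rewrite addrC addKr.
Qed.
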